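(* Let $(\mathcal{Y}_n)_{n\ge1}$ be the binary Hollywood process with parameter $(\alpha,\theta)$, where $0<\alpha<1$ and $\theta>-\alpha$. Fix any $c\ge0$. For each $n\ge1$ let $H_n^{c}$ be the graph whose vertex set is the vertex set of $\mathcal{Y}_n$ and whose edges are the ordered pairs $A$ such that $\#\{i\le n:X_i=A\}>c$. Then, almost surely, $$\limsup_{n\to\infty}\frac{e(H_n^{c})}{v(H_n^{c})^2}=0,$$ i.e. $(H_n^{c})_{n\ge1}$ is sparse almost surely.
   Context: Binary Hollywood process with parameter $(\alpha,\theta)$: generate $X_1,X_2,\dots$, each $X_n=(X_{n,1},X_{n,2})$ an ordered pair of positive integer labels, chosen sequentially as follows. Let $V_n(j)$ be the number of distinct labels among $X_1,\dots,X_{n-1},X_{n,1},\dots,X_{n,j-1}$ (labels $1,2,\dots$ assigned in order of first appearance), and for $i\le V_n(j)$ let $D_{n,j}(i)$ be the number of occurrences of label $i$ among these. Then $\mathrm{pr}(X_{n,j}=i\mid\text{past})\propto D_{n,j}(i)-\alpha$ for $i=1,\dots,V_n(j)$ and $\propto\theta+\alpha V_n(j)$ for $i=V_n(j)+1$. $\mathcal{Y}_n$ is the network with (possibly repeated, possibly loop) edges $X_1,\dots,X_n$. The graph $H_n^c$ is the $(t,c)$-projection of $\mathcal{Y}_n$ with $t$ the cardinality map: multiple occurrences of the same pair are collapsed into a single edge if they occur more than $c$ times, and discarded otherwise; $e(H_n^c)$ is its number of edges and $v(H_n^c)$ is the number of vertices of $\mathcal{Y}_n$. *)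

(* Defs.v *)
From HB Require Import structures.
From mathcomp Require Import all_boot all_order all_algebra.
From mathcomp Require Import all_classical all_reals all_analysis.
Set Implicit Arguments. Unset Strict Implicit. Unset Printing Implicit Defensive.
Import Order.TTheory GRing.Theory Num.Theory.
Local Open Scope ring_scope.

(* The labels of the binary Hollywood process are flattened into one sequence
   Z_0, Z_1, Z_2, ... with X_n = (Z_{2(n-1)}, Z_{2(n-1)+1}) for n >= 1.
   [hollywood_pred alpha theta s i] is the conditional probability that the
   next label equals i, given that the labels so far are the sequence s.
   (labels are positive integers 1,2,... assigned in order of first appearance;
   V = number of distinct labels so far, D(i) = count of i in s.) *)
Definition hollywood_pred {R : realType} (alpha theta : R) (s : seq nat) (i : nat) : R :=
  let k := size s in
  let V := size (undup s) in
  if k == 0%N then (i == 1%N)%:R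
  else if (1 <= i <= V)%N then ((count_mem i s)%:R - alpha) / (k%:R + theta)
  else if i == V.+1 then (theta + alpha * V%:R) / (k%:R + theta)
  else 0.

Definition hw_edges {T : Type} (Z : nat -> T -> nat) (w : T) (n : nat) : seq (nat * nat) :=
  [seq (Z (2 * m)%N w, Z (2 * m).+1 w) | m <- iota 0 n].

Definition hw_v {T : Type} (Z : nat -> T -> nat) (w : T) (n : nat) : nat :=
  size (undup [seq Z j w | j <- iota 0 (2 * n)]).

Definition hw_e {R : realType} {T : Type} (c : R) (Z : nat -> T -> nat) (w : T) (n : nat) : nat :=
  let xs := hw_edges Z w n in
  size [seq A <- undup xs | c < (count_mem A xs)%:R].

Definition hw_ratio {R : realType} {T : Type} (c : R) (Z : nat -> T -> nat) (w : T) (n : nat) : R :=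
  (hw_e c Z w n)%:R / ((hw_v Z w n)%:R ^+ 2).

(* Main.v *)
Require Import Defs.
From HB Require Import structures.
From mathcomp Require Import all_boot all_order all_algebra.
From mathcomp Require Import all_classical all_reals all_analysis.
From mathcomp Require Import zify ring lra.
Set Implicit Arguments.
Unset Strict Implicit.
Import Order.TTheory GRing.Theory Num.Theory.
Import numFieldNormedType.Exports.
Local Open Scope classical_set_scope.
Local Open Scope ring_scope.

(* Let V be the number of labels and N_K the number of labels of degree above K.
   Every distinct edge either has an endpoint of degree at most K, which accounts
   for at most K V edges, or joins two of the N_K other labels, so that
   e <= K V + N_K^2. It remains to see that almost surely V tends to infinity and
   that limsup N_K / V tends to 0 as K grows.

   Both follow from one nonnegative supermartingale. For small a > 0 put
   g(d) = (1/2) prod_(1 <= j < d) (1 + a / (j - alpha)). Drawing an old label of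
   degree d has probability proportional to d - alpha and multiplies its factor by
   1 + a / (d - alpha), so the old labels contribute a drift a V; a new label
   halves the product and contributes the drift -(theta + alpha V) / 2, which is
   at most -2 a V. Hence prod_i g(D_i) is a supermartingale after k labels even
   when multiplied by prod_(1 <= j < k) (1 + a / (j + theta)), and by Ville's
   inequality this product is almost surely bounded. Since g(d) >= 1/2, and both
   g and the time factor are unbounded, the bound forces 2^V to infinity and
   bounds (2 g(K+1))^(N_K) by a constant times 2^V. *)

(** * Counting edges by the degrees of their endpoints *)

Lemma sum_count_undup (T : eqType) (p : pred T) (s : seq T) :
  (\sum_(i <- undup s | p i) count_mem i s)%N = count p s.
Proof.
rewrite -sum1_count -[RHS]big_undup_iterop_count; apply: eq_bigr => i _.
by case: (count_mem i s) => // n; rewrite iteropS; elim: n => //= n <-.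
Qed.

Definition labels {T : Type} (Z : nat -> T -> nat) (w : T) (n : nat) : seq nat :=
  [seq Z j w | j <- iota 0 n].

Definition n_high (K : nat) (s : seq nat) : nat :=
  count (fun i => K < count_mem i s)%N (undup s).

(** An edge that fails [p] at some endpoint supplies a failing position among its own two positions,
    and different draws use disjoint positions. *)
Lemma count_hw_edges (T : Type) (Z : nat -> T -> nat) (w : T) (n : nat)
    (p : pred nat) :
  (count (fun A => ~~ (p A.1 && p A.2)) (hw_edges Z w n) <=
   count (predC p) (labels Z w (2 * n)))%N.
Proof.
elim: n => [|n IHn] //.
rewrite /hw_edges /labels -(addn1 n) iotaD map_cat count_cat mulnDr iotaD map_cat count_cat.
apply: leq_add; first exact: IHn.
by rewrite /= !add0n !addn0; case: (p _); case: (p _).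
Qed.

(* An edge with an endpoint of degree at most K is charged to that endpoint;
   every other distinct edge is a pair of endpoints of degree above K. *)
Lemma hw_e_le (R : realType) (c : R) (T : Type) (Z : nat -> T -> nat) (w : T)
    (n K : nat) :
  (hw_e c Z w n <= K * hw_v Z w n + n_high K (labels Z w (2 * n)) ^ 2)%N.
Proof.
rewrite /hw_v -/(labels Z w (2 * n)); set s := labels Z w (2 * n).
rewrite /n_high; set hi := (fun i => K < count_mem i s)%N.
rewrite /hw_e size_filter; apply: (leq_trans (count_size _ _)).
set both := fun A : nat * nat => hi A.1 && hi A.2.
rewrite -(count_predC both) addnC; apply: leq_add.
  apply: (leq_trans (count_undup _ _)).
  apply: (leq_trans (@count_hw_edges T Z w n hi)); rewrite -/s.
  rewrite -sum_count_undup mulnC -sum1_size big_distrl /=.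
  rewrite [leqRHS](bigID (predC hi)) /=; apply: (leq_trans _ (leq_addr _ _)).
  by apply: leq_sum => i; rewrite mul1n -leqNgt.
rewrite -!size_filter -mulnn -(size_allpairs pair).
apply: uniq_leq_size; first by rewrite filter_uniq ?undup_uniq.
move=> [a b]; rewrite mem_filter mem_undup => /andP[/andP[/= ha hb] /mapP[m]].
rewrite mem_iota /= add0n => mn [ea eb].
by apply/allpairsP; exists (a, b); rewrite /= !mem_filter !mem_undup ha hb ea eb;
  split=> //; apply: map_f; rewrite mem_iota; lia.
Qed.

(** * Products that grow like the power d^a *)

Definition growth {R : realType} (a t : R) (d : nat) : R :=
  \prod_(1 <= j < d) (1 + a / (j%:R + t)).

Lemma growthS (R : realType) (a t : R) (d : nat) :
  (0 < d)%N -> growth a t d.+1 = growth a t d * (1 + a / (d%:R + t)).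
Proof. by move=> d0; rewrite /growth big_nat_recr. Qed.

Lemma shifted_nat_gt0 (R : realType) (t : R) (d : nat) :
  -1 < t -> (0 < d)%N -> 0 < d%:R + t.
Proof. by move=> t1; rewrite -(ler_nat R) => d1; lra. Qed.

Lemma growth_leS (R : realType) (a t : R) (d : nat) : 0 <= a -> -1 < t ->
  1 <= growth a t d /\ growth a t d <= growth a t d.+1.
Proof.
move=> a0 t1; elim: d => [|d [IH1 IH2]].
  by rewrite /growth !big_geq.
have g1 : 1 <= growth a t d.+1 by lra.
split=> //; rewrite [leRHS]growthS // ler_peMr ?(le_trans ler01) //.
by rewrite lerDl divr_ge0 // ltW // shifted_nat_gt0.
Qed.

Lemma growth_ge1 (R : realType) (a t : R) (d : nat) :
  0 <= a -> -1 < t -> 1 <= growth a t d.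
Proof. by move=> a0 t1; have [] := growth_leS d a0 t1. Qed.

Lemma growth_le (R : realType) (a t : R) (d e : nat) : 0 <= a -> -1 < t ->
  (d <= e)%N -> growth a t d <= growth a t e.
Proof.
move=> a0 t1; apply: (homo_leq (r := fun x y : R => x <= y)) => //.
  by move=> y x z; apply: le_trans.
by move=> i; have [] := growth_leS i a0 t1.
Qed.

(** An elementary form of the divergence of the harmonic series: each new factor adds at least a /
    (3 d), since its denominator is at most 3 d and the product before it is at least 1. Doubling d
    therefore adds a / 3. *)
Lemma growth_double (R : realType) (a t : R) (d k : nat) : 0 <= a -> -1 < t ->
  (0 < d)%N -> t <= d%:R -> (k <= d)%N ->
  growth a t d + k%:R * (a / (3 * d%:R)) <= growth a t (d + k).
Proof.
move=> a0 t1 d0 td; elim: k => [|k IHk] kd; first by rewrite mul0r addr0 addn0.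
rewrite addnS growthS ?addn_gt0 ?d0 // mulrDr mulr1 -natr1 mulrDl mul1r addrA.
apply: lerD; first exact/IHk/ltnW.
have h : 0 < (d + k)%:R + t by apply: shifted_nat_gt0 => //; rewrite addn_gt0 d0.
have d0' : 0 < d%:R :> R by rewrite ltr0n.
have kd' : k%:R <= d%:R :> R by rewrite ler_nat ltnW.
apply: (@le_trans _ _ (a / ((d + k)%:R + t))); last first.
  by rewrite ler_peMl ?growth_ge1 // divr_ge0 // ltW.
apply: ler_wpM2l => //; rewrite lef_pV2 ?posrE //; last by lra.
by rewrite natrD; lra.
Qed.

Lemma growth_unbounded (R : realType) (a t B : R) : 0 < a -> -1 < t ->
  exists d, B <= growth a t d.
Proof.
move=> a0 t1.
have dbl n : exists d, [/\ (0 < d)%N, t <= d%:R & n%:R * (a / 3) <= growth a t d].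
  elim: n => [|n [d [d0 td IH]]].
    exists (Num.bound `|t|).+1; split=> //.
      apply: ltW; apply: le_lt_trans (ler_norm t) _.
      by apply: lt_trans (archi_boundP (normr_ge0 t)) _; rewrite ltr_nat.
    by rewrite mul0r (le_trans ler01) // growth_ge1 // ltW.
  exists (d + d)%N; split; first by rewrite addn_gt0 d0.
    by rewrite natrD (le_trans td) // lerDl.
  apply: le_trans (growth_double (ltW a0) t1 d0 td (leqnn d)).
  rewrite -natr1 mulrDl mul1r; apply: lerD => //.
  have d0' : d%:R != 0 :> R by rewrite pnatr_eq0 -lt0n.
  by rewrite le_eqVlt; apply/orP; left; apply/eqP; field.
have [d [_ _ hd]] := dbl (Num.bound `|B / (a / 3)|).
exists d; apply: le_trans hd; rewrite -ler_pdivrMr; last by lra.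
by apply: ltW; apply: le_lt_trans (ler_norm _) (archi_boundP _).
Qed.

(** * The potential and its one-step drift *)

Definition potential {R : realType} (alpha theta a : R) (s : seq nat) : R :=
  growth a theta (size s) *
  \prod_(i <- undup s) (growth a (- alpha) (count_mem i s) / 2).

Definition path_prob {R : realType} (alpha theta : R) (s : seq nat) : R :=
  \prod_(j < size s) hollywood_pred alpha theta (take j s) (nth 0%N s j).

(** [undup] keeps last occurrences, so its order is not that of first appearance. Only the set of
    labels matters here: it is {1, ..., V}, which turns the range test of [hollywood_pred] into
    membership in [s]. *)
Definition labelled_in_order (s : seq nat) : bool :=
  perm_eq (undup s) (iota 1 (size (undup s))).

Lemma count_mem_rcons (T : eqType) (s : seq T) (i j : T) :
  count_mem j (rcons s i) = (count_mem j s + (i == j))%N.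
Proof. by rewrite -cats1 count_cat /= addn0. Qed.

Lemma perm_undup_rcons (T : eqType) (s : seq T) (i : T) :
  i \in s -> perm_eq (undup (rcons s i)) (undup s).
Proof.
move=> si; apply: perm_undup => j.
by rewrite mem_rcons in_cons; case: eqP => // ->.
Qed.

Lemma undup_rcons_notin (T : eqType) (s : seq T) (i : T) :
  i \notin s -> undup (rcons s i) = rcons (undup s) i.
Proof.
move=> si; rewrite undup_rcons; congr rcons; apply/all_filterP/allP => j.
by rewrite mem_undup; apply: contraTneq => ->.
Qed.

Lemma potential_rcons_old (R : realType) (alpha theta a : R) (s : seq nat) (i : nat) :
  i \in s ->
  potential alpha theta a (rcons s i) = potential alpha theta a s *
    (1 + a / ((size s)%:R + theta)) * (1 + a / ((count_mem i s)%:R - alpha)).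
Proof.
move=> si; have s0 : (0 < size s)%N by case: s si.
rewrite /potential size_rcons growthS //.
rewrite (perm_big _ (perm_undup_rcons si)).
rewrite (bigD1_seq i) ?mem_undup ?undup_uniq //=.
rewrite [in RHS](bigD1_seq i) ?mem_undup ?undup_uniq //=.
rewrite count_mem_rcons eqxx addn1 growthS; last by rewrite -has_count has_pred1.
under eq_bigr => j ji do rewrite count_mem_rcons eq_sym (negbTE ji) addn0.
by ring.
Qed.

Lemma potential_rcons_new (R : realType) (alpha theta a : R) (s : seq nat) (i : nat) :
  (0 < size s)%N -> i \notin s ->
  potential alpha theta a (rcons s i) = potential alpha theta a s *
    (1 + a / ((size s)%:R + theta)) / 2.
Proof.
move=> s0 si; rewrite /potential size_rcons growthS // undup_rcons_notin //.
rewrite -[X in \prod_(_ <- X) _]cats1 big_cat big_seq1 /=.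
rewrite count_mem_rcons eqxx (count_memPn si) [growth _ _ (0 + 1)]big_geq //.
rewrite (eq_big_seq (fun j => growth a (- alpha) (count_mem j s) / 2)).
  by ring.
move=> j; rewrite mem_undup => sj; rewrite count_mem_rcons.
by have /negbTE-> : i != j; [apply: contraNneq si => -> | rewrite addn0].
Qed.

Lemma potential_ge0 (R : realType) (alpha theta a : R) (s : seq nat) :
  0 <= a -> alpha < 1 -> -1 < theta -> 0 <= potential alpha theta a s.
Proof.
move=> a0 al th; apply: mulr_ge0; first by rewrite (le_trans ler01) ?growth_ge1.
apply: prodr_ge0 => i _; rewrite divr_ge0 // (le_trans ler01) ?growth_ge1 //.
by rewrite ltrN2.
Qed.

Lemma labelled_mem (s : seq nat) (i : nat) : labelled_in_order s ->
  (i \in s) = (1 <= i <= size (undup s))%N.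
Proof. by move=> /perm_mem/(_ i); rewrite mem_undup mem_iota add1n ltnS. Qed.

Lemma labelled_rcons (s : seq nat) (i : nat) : labelled_in_order s ->
  (1 <= i <= (size (undup s)).+1)%N -> labelled_in_order (rcons s i).
Proof.
move=> gs; rewrite /labelled_in_order; have [si _|si] := boolP (i \in s).
  have p := perm_undup_rcons si.
  by rewrite (perm_size p); apply: perm_trans p gs.
have := si; rewrite labelled_mem // => hi hi'.
have -> : i = (size (undup s)).+1 by lia.
have ei : (size (undup s)).+1 = i by lia.
rewrite ei undup_rcons_notin // size_rcons -[(size _).+1]addn1 iotaD add1n ei /= cats1.
by rewrite -!cats1 perm_cat2r.
Qed.

Lemma path_prob_rcons (R : realType) (alpha theta : R) (s : seq nat) (i : nat) :
  path_prob alpha theta (rcons s i) =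
  path_prob alpha theta s * hollywood_pred alpha theta s i.
Proof.
rewrite /path_prob size_rcons big_ord_recr /= nth_rcons ltnn eqxx.
rewrite -cats1 take_size_cat //; congr (_ * _); apply: eq_bigr => j _.
by rewrite nth_cat ltn_ord takel_cat // ltnW.
Qed.

(** Only the labels 1, ..., V + 1 have nonzero conditional probability, and appending one of them
    keeps the label set an initial segment. *)
Lemma labelled_of_path_prob (R : realType) (alpha theta : R) (s : seq nat) :
  path_prob alpha theta s != 0 -> labelled_in_order s.
Proof.
elim/last_ind: s => // s i IHs; rewrite path_prob_rcons mulf_eq0 negb_or.
move=> /andP[/IHs gs]; rewrite /hollywood_pred.
case: ifP => [/nilP->|_]; first by case: (i =P 1%N) => [->|_]; rewrite ?eqxx.
case: ifP => [hi _|_]; first by apply: labelled_rcons => //; lia.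
by case: (i =P _) => [-> _|_]; rewrite ?eqxx //; apply: labelled_rcons => //; lia.
Qed.

(** The next label ranges over all naturals, and its countable sum is handled through the partial
    sums over i < N. Seen labels outside this range have nonnegative terms, which are dropped. *)
Lemma sum_mem_le (R : realType) (s : seq nat) (F : nat -> R) (N : nat) :
  (forall i, i \in s -> 0 <= F i) ->
  \sum_(i < N) (if (i : nat) \in s then F i else 0) <= \sum_(i <- undup s) F i.
Proof.
move=> F0; rewrite -(big_mkord xpredT (fun i => if i \in s then F i else 0)).
rewrite -big_mkcond /= -big_filter.
have pe : perm_eq [seq i <- index_iota 0 N | i \in s]
                  [seq i <- undup s | (i < N)%N].
  apply: uniq_perm; rewrite ?filter_uniq ?iota_uniq ?undup_uniq // => i.
  by rewrite !mem_filter mem_index_iota mem_undup andbC.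
rewrite (perm_big _ pe) big_filter [leRHS](bigID (fun i => (i < N)%N)) /= lerDl.
by rewrite big_seq_cond sumr_ge0 // => i /andP[]; rewrite mem_undup => /F0.
Qed.

Lemma sum_delta_le (R : realType) (k : nat) (y : R) (N : nat) :
  0 <= y -> \sum_(i < N) (if (i : nat) == k then y else 0) <= y.
Proof.
move=> y0; have := @sum_mem_le R [:: k] (fun=> y) N (fun _ _ => y0).
by rewrite /= big_seq1; apply: le_trans; apply: ler_sum => i _; rewrite inE.
Qed.

(** Here k is the time and v the number of labels. The new-label weight theta + alpha v = (theta +
    alpha) + alpha (v - 1) is at least 4 a v, so halving it loses 2 a v, against a gain of a v from
    old labels. The net loss is at least a. *)
Lemma drift_le (R : realFieldType) (alpha theta a k v : R) :
  0 <= a -> 4 * a <= alpha -> 4 * a <= alpha + theta -> 1 <= v ->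
  0 <= (theta + alpha * v) / 2 /\
  k - alpha * v + a * v + (theta + alpha * v) / 2 <= k + theta - a.
Proof.
move=> a0 a1 a2 v1.
have av : a <= a * v by rewrite ler_peMr.
have : 0 <= (alpha - 4 * a) * (v - 1) by rewrite mulr_ge0 // subr_ge0.
by split; lra.
Qed.

Lemma potential_step (R : realType) (alpha theta a : R) (s : seq nat) (N : nat) :
  alpha < 1 -> -1 < theta -> 0 <= a -> 4 * a <= alpha ->
  4 * a <= alpha + theta -> labelled_in_order s ->
  \sum_(i < N) hollywood_pred alpha theta s i * potential alpha theta a (rcons s i)
  <= potential alpha theta a s.
Proof.
move=> al th a0 a1 a2 gs.
have [s0|] := posnP (size s).
  (* The first label is surely 1, and the potential drops from 1 to 1/2. *)
  rewrite (size0nil s0) /hollywood_pred /potential /= big_nil.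
  under eq_bigr => i _ do rewrite big_seq1 /= eqxx addn0 /growth !big_geq //
     mul1r mul1r mulrC mulr_natr mulrb.
  rewrite /growth big_geq // mulr1.
  by apply: le_trans (sum_delta_le 1 N _) _; rewrite ?divr_ge0 //; lra.
move=> s0; set U := potential alpha theta a s.
have U0 : 0 <= U by exact: potential_ge0.
set k : R := (size s)%:R; set V := size (undup s).
have k0 : 0 < k + theta by exact: shifted_nat_gt0.
have V1 : 1 <= V%:R :> R.
  by rewrite ler1n /V lt0n size_eq0; apply: contraTneq s0 => /undup_nil->.
set y := a / (k + theta).
have y0 : 0 <= y by rewrite divr_ge0 // ltW.
have c1 i : i \in s -> 0 < (count_mem i s)%:R - alpha.
  by move=> si; rewrite shifted_nat_gt0 ?ltrN2 // -has_count has_pred1.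
have [tV0 drift] := drift_le k a0 a1 a2 V1.
(* An old label of degree D contributes (D - alpha) (1 + a / (D - alpha)) = D - alpha + a, and the
   new label half its weight; the time factor 1 + y is common to both. *)
rewrite (eq_bigr (fun i : 'I_N => U * (1 + y) / (k + theta) *
   ((if (i : nat) \in s then (count_mem (i : nat) s)%:R - alpha + a else 0) +
    (if (i : nat) == V.+1 then (theta + alpha * V%:R) / 2 else 0)))); last first.
  move=> i _; rewrite /hollywood_pred gtn_eqF // -/k -/V -labelled_mem //.
  case: ifPn => si.
    have /c1 ci := si; have := si; rewrite labelled_mem // => /andP[_ iV].
    rewrite ltn_eqF ?ltnS //.
    rewrite potential_rcons_old // -/U -/k -/y addr0.
    by field; rewrite !gt_eqF.
  case: ifP => iV; last by rewrite mul0r addr0 mulr0.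
  rewrite potential_rcons_new // -/U -/k -/y add0r.
  by field; rewrite gt_eqF.
rewrite -mulr_sumr big_split /=.
have sumF : \sum_(i <- undup s) ((count_mem i s)%:R - alpha + a) =
    k - alpha * V%:R + a * V%:R.
  under eq_bigr => i _ do rewrite -addrA.
  rewrite big_split /= -natr_sum (sum_count_undup predT) count_predT -/k.
  by rewrite big_const_seq count_predT iter_addr_0 -/V -mulr_natr; ring.
have F0 i : i \in s -> 0 <= (count_mem i s)%:R - alpha + a.
  by move=> /c1 ?; lra.
have S1 := sum_mem_le N F0; rewrite sumF in S1.
have S2 := sum_delta_le V.+1 N tV0.
(* The net loss a gives a factor 1 - y, which absorbs the time factor: (1 - y) (1 + y) <= 1. *)
apply: (@le_trans _ _ (U * (1 + y) / (k + theta) * (k + theta - a))).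
  apply: ler_wpM2l; last exact: le_trans (lerD S1 S2) drift.
  by apply: divr_ge0; [apply: mulr_ge0 => //; apply: addr_ge0 | apply: ltW].
have -> : U * (1 + y) / (k + theta) * (k + theta - a) = U * ((1 - y) * (1 + y)).
  by rewrite /y; field; rewrite gt_eqF.
by rewrite ler_piMr // -subr_sqr expr1n lerBlDr lerDl sqr_ge0.
Qed.

(** Weighting by [path_prob] removes the condition on labelling, because sequences of probability
    zero contribute nothing. *)
Lemma path_prob_potential_step (R : realType) (alpha theta a : R) (s : seq nat)
    (N : nat) :
  alpha < 1 -> -1 < theta -> 0 <= a -> 4 * a <= alpha ->
  4 * a <= alpha + theta -> 0 <= path_prob alpha theta s ->
  \sum_(i < N) path_prob alpha theta (rcons s i) * potential alpha theta a (rcons s i)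
  <= path_prob alpha theta s * potential alpha theta a s.
Proof.
move=> al th a0 a1 a2 p0.
under eq_bigr => i _ do rewrite path_prob_rcons -mulrA.
rewrite -mulr_sumr; have [->|pn] := eqVneq (path_prob alpha theta s) 0.
  by rewrite !mul0r.
by apply: ler_wpM2l => //; apply: potential_step => //; apply: labelled_of_path_prob pn.
Qed.

(** * Sparsity along a path with bounded potential *)

Lemma potential_lower (R : realType) (alpha theta a : R) (K : nat) (s : seq nat) :
  0 <= a -> alpha < 1 -> -1 < theta ->
  growth a theta (size s) * growth a (- alpha) K.+1 ^+ n_high K s <=
  potential alpha theta a s * 2 ^+ size (undup s).
Proof.
move=> a0 al th; rewrite /potential -mulrA.
apply: ler_wpM2l; first by rewrite (le_trans ler01) ?growth_ge1.
rewrite -(count_predT (undup s)) -!iter_mulr_1 -!big_const_seq.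
rewrite -big_split /= [leLHS]big_mkcond /=.
apply: ler_prod => i _; rewrite divfK //.
by case: ifP => Ki; rewrite ?ler01 ?growth_ge1 ?ltrN2 // growth_le ?ltrN2 //
  (le_trans ler01) ?growth_ge1 ?ltrN2.
Qed.

Lemma size_labels (T : Type) (Z : nat -> T -> nat) (w : T) (n : nat) :
  size (labels Z w n) = n.
Proof. by rewrite size_map size_iota. Qed.

Lemma bounded_potential_cvg (R : realType) (alpha theta a c : R) (T : Type)
    (Z : nat -> T -> nat) (w : T) (m : nat) :
  0 < a -> alpha < 1 -> -1 < theta ->
  (forall k, potential alpha theta a (labels Z w k) <= m%:R) ->
  hw_ratio c Z w n.+1 @[n --> \oo] --> (0 : R).
Proof.
move=> a0 al th Um.
have al' : -1 < - alpha by rewrite ltrN2.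
(* Replacing m by 2^m makes the right side a power of 2, so that the next two bounds come from
   comparing exponents. *)
have key K k : growth a theta k * growth a (- alpha) K.+1 ^+ n_high K (labels Z w k)
    <= 2 ^+ (m + size (undup (labels Z w k))).
  have := potential_lower K (labels Z w k) (ltW a0) al th; rewrite size_labels.
  move=> /le_trans; apply; rewrite exprD ler_pM2r ?exprn_gt0 //.
  by rewrite (le_trans (Um k)) // -natrX ler_nat ltnW // ltn_expl.
(* The time factor alone eventually exceeds 2^(m + B). *)
have vtx B : exists k0, forall k, (k0 <= k)%N -> (B <= size (undup (labels Z w k)))%N.
  have [k0 hk0] := growth_unbounded (2 ^+ (m + B)) a0 th.
  exists k0 => k k0k; rewrite -(leq_add2l m) -(ler_eXn2l (x := 2 : R)) ?ltr1n //.
  apply: le_trans (key 0%N k); apply: le_trans hk0 _.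
  apply: le_trans (growth_le (ltW a0) th k0k) _.
  apply: ler_peMr; first by rewrite (le_trans ler01) // growth_ge1 // ltW.
  by rewrite exprn_ege1 // growth_ge1 // ltW.
(* With K such that the growth product is at least 2^M, each label of degree above K costs M in the
   exponent. *)
have few M : exists K, forall k,
    (M * n_high K (labels Z w k) <= m + size (undup (labels Z w k)))%N.
  have [K hK] := growth_unbounded (2 ^+ M) a0 al'.
  exists K => k; rewrite -(ler_eXn2l (x := 2 : R)) ?ltr1n // exprM.
  apply: le_trans (key K k).
  apply: (@le_trans _ _ (growth a (- alpha) K.+1 ^+ n_high K (labels Z w k))).
    apply: lerXn2r; rewrite ?nnegrE ?exprn_ge0 //.
      by rewrite (le_trans ler01) // growth_ge1 // ltW.
    by rewrite (le_trans hK) // growth_le // ltW.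
  apply: ler_peMl; last by rewrite growth_ge1 // ltW.
  by rewrite exprn_ge0 // (le_trans ler01) // growth_ge1 // ltW.
apply/cvgrPdist_le => e e0.
(* Each of the terms K V and N^2 is to be at most e V^2 / 2. The first needs V >= 2 K / e; the
   second follows from M N <= 2 V, valid once V >= m, and M >= 8 / e. *)
pose M := (Num.bound (8 / e)).+1.
have M1 : 1 <= M%:R :> R by rewrite ler1n.
have Me : 8 <= M%:R * e.
  rewrite -ler_pdivrMr // ltW // (lt_trans (archi_boundP _)) ?ltr_nat //.
  by rewrite divr_ge0 // ltW.
have [K hK] := few M.
have [k0 hk0] := vtx (m + (Num.bound (2 * K%:R / e)).+1)%N.
exists k0 => // n /= k0n.
rewrite sub0r normrN ger0_norm; last by rewrite divr_ge0 // exprn_ge0.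
have {hk0} := hk0 (2 * n.+1)%N ltac:(lia); have {hK} := hK (2 * n.+1)%N.
have := hw_e_le c Z w n.+1 K; rewrite /hw_ratio.
have -> : size (undup (labels Z w (2 * n.+1))) = hw_v Z w n.+1 by [].
set E := hw_e _ _ _ _; set V := hw_v _ _ _; set N := n_high _ _.
move=> hE hN hV.
have V0 : 0 < V%:R :> R by rewrite ltr0n; lia.
have KV : 2 * K%:R <= e * V%:R.
  have b0 : 0 <= 2 * K%:R / e by rewrite divr_ge0 ?mulr_ge0 ?(ltW e0).
  rewrite [leRHS]mulrC -ler_pdivrMr //; apply: ltW.
  by apply: lt_le_trans (archi_boundP b0) _; rewrite ler_nat; lia.
have NV : M%:R * N%:R <= 2 * V%:R :> R by rewrite -!natrM ler_nat; lia.
have EV : E%:R <= K%:R * V%:R + N%:R ^+ 2 :> R.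
  by rewrite -natrM -natrX -natrD ler_nat.
rewrite ler_pdivrMr ?exprn_gt0 //; apply: le_trans EV _.
clearbody E V N M; clear - e0 M1 Me V0 KV NV.
(* The chain is 8 N^2 <= e M N^2 <= e M^2 N^2 <= 4 e V^2. *)
have h1 : 2 * K%:R * V%:R <= e * V%:R * V%:R by rewrite ler_pM2r.
have N0 : 0 <= N%:R :> R by [].
have h2 : M%:R * N%:R * (M%:R * N%:R) <= 2 * V%:R * (2 * V%:R) :> R.
  by apply: ler_pM => //; apply: mulr_ge0; lra.
have h3 : 8 * N%:R ^+ 2 <= M%:R * e * N%:R ^+ 2 :> R by rewrite ler_wpM2r ?exprn_ge0.
have h4 : e * (M%:R * N%:R ^+ 2) <= e * (M%:R * (M%:R * N%:R ^+ 2)) :> R.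
  by rewrite ler_pM2l //; apply: ler_peMl => //; apply: mulr_ge0; rewrite ?exprn_ge0.
have h5 : e * (M%:R * N%:R * (M%:R * N%:R)) <= e * (2 * V%:R * (2 * V%:R)).
  by rewrite ler_pM2l.
by rewrite !expr2 in h3 h4 *; lra.
Qed.

(** * Cylinder events and the maximal inequality *)

Definition cylinder {T : Type} (Z : nat -> T -> nat) (s : seq nat) : set T :=
  [set w | forall j : nat, (j < size s)%N -> Z j w = nth 0%N s j].

Lemma nth_labels (T : Type) (Z : nat -> T -> nat) (w : T) (n j : nat) :
  (j < n)%N -> nth 0%N (labels Z w n) j = Z j w.
Proof. by move=> jn; rewrite (nth_map 0%N) ?size_iota // nth_iota. Qed.

Lemma cylinderP (T : Type) (Z : nat -> T -> nat) (s : seq nat) (w : T) :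
  cylinder Z s w <-> labels Z w (size s) = s.
Proof.
split=> [h|e j js]; last by rewrite -e nth_labels.
apply: (@eq_from_nth _ 0%N); rewrite size_labels // => j js.
by rewrite nth_labels // h.
Qed.

Lemma labelsS (T : Type) (Z : nat -> T -> nat) (w : T) (n : nat) :
  labels Z w n.+1 = rcons (labels Z w n) (Z n w).
Proof. by rewrite /labels -addn1 iotaD map_cat /= cats1. Qed.

Lemma measurable_cylinder (d : measure_display) (T : measurableType d)
    (Z : nat -> T -> nat) (s : seq nat) :
  (forall j i : nat, measurable (Z j @^-1` [set i])) -> measurable (cylinder Z s).
Proof.
move=> mZ.
have -> : cylinder Z s = \bigcap_(j in `I_(size s)) Z j @^-1` [set nth 0%N s j].
  by apply/seteqP; split.
exact: bigcap_measurableType.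
Qed.

(** There are countably many finite label sequences, so the event is a countable union of
    cylinders. *)
Lemma measurable_labels (d : measure_display) (T : measurableType d)
    (Z : nat -> T -> nat) (Q : set (seq nat)) (n : nat) :
  (forall j i : nat, measurable (Z j @^-1` [set i])) ->
  measurable [set w | Q (labels Z w n)].
Proof.
move=> mZ.
have -> : [set w | Q (labels Z w n)] =
    \bigcup_s (if pselect (Q s /\ size s = n) then cylinder Z s else set0).
  apply/seteqP; split=> w /=.
    move=> Qw; exists (labels Z w n) => //.
    case: pselect => [q|[]]; last by rewrite size_labels.
    by apply/cylinderP; rewrite size_labels.
  move=> [s _]; case: pselect => // -[Qs sn] /cylinderP.
  by rewrite sn => ->.
apply: countable_bigcupT_measurable => // s.
by case: pselect => q; [exact: measurable_cylinder | exact: measurable0].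
Qed.

(** The finite horizon n allows induction on n with the starting sequence varying. *)
Definition hits {R : realType} {T : Type} (Z : nat -> T -> nat) (F : seq nat -> R)
    (x : R) (s : seq nat) (n : nat) : set T :=
  cylinder Z s `&`
  \bigcup_(k in [set k | (k <= n)%N]) [set w | x <= F (labels Z w (size s + k))].

Lemma measurable_hits (R : realType) (d : measure_display) (T : measurableType d)
    (Z : nat -> T -> nat) (F : seq nat -> R) (x : R) (s : seq nat) (n : nat) :
  (forall j i : nat, measurable (Z j @^-1` [set i])) -> measurable (hits Z F x s n).
Proof.
move=> mZ; apply: measurableI; first exact: measurable_cylinder.
by apply: bigcup_measurable => k _;
   exact: (measurable_labels [set s | x <= F s] _ mZ).
Qed.

(* Ville's maximal inequality for the supermartingale [F], started at [s]. *)
Lemma hits_le (R : realType) (d : measure_display) (T : measurableType d)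
    (P : probability T R) (Z : nat -> T -> nat) (p F : seq nat -> R) (x : R)
    (s : seq nat) (n : nat) :
  (forall j i : nat, measurable (Z j @^-1` [set i])) ->
  (forall s, P (cylinder Z s) = (p s)%:E) -> (forall s, 0 <= F s) -> 0 < x ->
  (forall (s : seq nat) N, \sum_(i < N) p (rcons s i) * F (rcons s i) <= p s * F s) ->
  (P (hits Z F x s n) <= (p s * F s / x)%:E)%E.
Proof.
move=> mZ Pp F0 x0 super.
have p0 t : 0 <= p t by rewrite -lee_fin -Pp.
have hit0 t k : x <= F t -> (P (hits Z F x t k) <= (p t * F t / x)%:E)%E.
  move=> xF; apply: (@le_trans _ _ (P (cylinder Z t))).
    apply: le_measure; rewrite ?inE; last exact: subIsetl.
    - exact: measurable_hits.
    - exact: measurable_cylinder.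
  by rewrite Pp lee_fin -mulrA ler_peMr // ler_pdivlMr // mul1r.
elim: n s => [|n IHn] s; have [xF|Fx] := leP x (F s).
- exact: hit0.
- rewrite (_ : hits _ _ _ _ _ = set0) ?measure0 ?lee_fin.
    by rewrite divr_ge0 ?mulr_ge0 // ltW.
  apply/seteqP; split=> // w [/cylinderP sw [k]] /=.
  by rewrite leqn0 => /eqP->; rewrite addn0 sw leNgt Fx.
- exact: hit0.
(* Below the level at [s], a hit must come after the next label i, with one step less to go. *)
have sub : hits Z F x s n.+1 `<=` \bigcup_i hits Z F x (rcons s i) n.
  move=> w [/cylinderP sw [k /= kn xF]].
  exists (Z (size s) w) => //; split.
    by apply/cylinderP; rewrite size_rcons labelsS sw.
  case: k kn xF => [|k] kn; first by rewrite addn0 sw leNgt Fx.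
  by exists k => //=; rewrite size_rcons addSnnS.
apply: le_trans (measure_sigma_subadditive _ _ _ sub) _.
- by move=> i; exact: measurable_hits.
- exact: measurable_hits.
apply: lime_le; first exact: is_cvg_nneseries.
apply: nearW => N; apply: (@le_trans _ _
    (\sum_(0 <= i < N) (p (rcons s i) * F (rcons s i) / x)%:E)%E).
  by apply: lee_sum => i _; exact: IHn.
rewrite sumEFin lee_fin -mulr_suml ler_pM2r ?invr_gt0 //.
by rewrite big_mkord.
Qed.

Lemma ae_bounded (R : realType) (d : measure_display) (T : measurableType d)
    (P : probability T R) (Z : nat -> T -> nat) (p F : seq nat -> R) :
  (forall j i : nat, measurable (Z j @^-1` [set i])) ->
  (forall s, P (cylinder Z s) = (p s)%:E) -> (forall s, 0 <= F s) ->
  (forall (s : seq nat) N, \sum_(i < N) p (rcons s i) * F (rcons s i) <= p s * F s) ->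
  {ae P, forall w, exists m : nat, forall k, F (labels Z w k) <= m%:R}.
Proof.
move=> mZ Pp F0 super.
(* The level is m + 1 because the maximal inequality needs a positive one. *)
pose A (m : nat) := \bigcup_n hits Z F m.+1%:R [::] n.
have mA m : measurable (A m).
  by apply: bigcup_measurable => n _; exact: measurable_hits.
have PA m : (P (A m) <= (p [::] * F [::] / m.+1%:R)%:E)%E.
  (* Continuity from below removes the horizon. *)
  have cvA : P (hits Z F m.+1%:R [::] n) @[n --> \oo] --> P (A m).
    apply: nondecreasing_cvg_mu; [by move=> n; exact: measurable_hits|exact: mA|].
    move=> i j ij; rewrite subsetEset => w [cw [k /= ki xF]]; split=> //.
    by exists k => //=; exact: leq_trans ij.
  rewrite -(cvg_lim _ cvA) //; apply: lime_le; first by apply/cvg_ex; eexists; exact: cvA.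
  by apply: nearW => n; exact: hits_le.
exists (\bigcap_m A m); split.
- exact: bigcap_measurableType.
- apply/eqP; rewrite eq_le measure_ge0 andbT; apply/lee_addgt0Pr => e e0.
  rewrite add0e; pose m := Num.bound (p [::] * F [::] / e).
  apply: (@le_trans _ _ (P (A m))).
    apply: le_measure; rewrite ?inE //; first exact: bigcap_measurableType.
    exact: bigcap_inf.
  apply: le_trans (PA m) _; rewrite lee_fin ler_pdivrMr //.
  rewrite [leRHS]mulrC -ler_pdivrMr //; apply: ltW.
  have b0 : 0 <= p [::] * F [::] / e.
    by rewrite divr_ge0 ?mulr_ge0 ?(ltW e0) // -lee_fin -Pp.
  by apply: lt_trans (archi_boundP b0) _; rewrite ltr_nat.
- move=> w /= nb m _; apply: contrapT => nA; apply: nb; exists m.+1 => k.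
  rewrite leNgt; apply/negP => Fk; apply: nA.
  exists k => //; split; first by [].
  by exists k => //=; rewrite add0n ltW.
Qed.

Theorem theorem5p4 (R : realType) (d : measure_display) (T : measurableType d)
  (P : probability T R) (alpha theta c : R) (Z : nat -> T -> nat) :
  0 < alpha -> alpha < 1 -> - alpha < theta -> 0 <= c ->
  (forall (j i : nat), measurable (Z j @^-1` [set i])) ->
  (forall s : seq nat,
     P [set w | forall j : nat, (j < size s)%N -> Z j w = nth 0%N s j] =
     (\prod_(j < size s) hollywood_pred alpha theta (take j s) (nth 0%N s j))%:E) ->
  {ae P, forall w, limn_esup (fun n => (hw_ratio c Z w n.+1)%:E) = 0%E}.
Proof.
move=> al0 al1 th _ mZ Pp.
have th1 : -1 < theta by lra.
(* The largest a allowed by both drift conditions; it is positive because alpha > 0 and theta > -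
   alpha. *)
pose a := Num.min alpha (alpha + theta) / 4.
have a0 : 0 < a by rewrite divr_gt0 // lt_min al0; lra.
have a1 : 4 * a <= alpha by rewrite /a mulrC divfK // ge_min lexx.
have a2 : 4 * a <= alpha + theta by rewrite /a mulrC divfK // ge_min lexx orbT.
have := @ae_bounded R d T P Z (path_prob alpha theta) (potential alpha theta a) mZ Pp.
case=> [s|s N|N [mN PN0 subN]].
- by apply: potential_ge0 => //; exact: ltW.
- apply: path_prob_potential_step => //; first exact: ltW.
  by rewrite -lee_fin -[X in (_ <= X)%E]Pp measure_ge0.
exists N; split=> // w nw; apply: subN => -[m Um]; apply: nw.
by apply: (cvg_limn_einf_sup _).2; apply: cvg_EFin; [exact: nearW|];
  exact: bounded_potential_cvg Um.
Qed.
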